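(* Let the marginal algorithm be an independent Metropolis--Hastings algorithm with target $\pi$ and proposal distribution $q(\mathrm dx)$, $\pi\ll q$, and let $\tilde P$ be the corresponding pseudo-marginal kernel with weight distributions $\{Q_x\}_{x\in\mathsf X}$. Write $\pi(\mathrm dx)/q(\mathrm dx)$ for the density of $\pi$ with respect to $q$ at $x$. Suppose either of the following holds: (a) for some $\gamma>0$, $\displaystyle\int\tilde\pi(\mathrm dx,\mathrm dw)\exp\Bigl[\Bigl(w\frac{\pi(\mathrm dx)}{q(\mathrm dx)}\Bigr)^\gamma\Bigr]<\infty$; (b) for some $\beta\ge1$, $\displaystyle\int\tilde\pi(\mathrm dx,\mathrm dw)\Bigl(w\frac{\pi(\mathrm dx)}{q(\mathrm dx)}\Bigr)^\beta<\infty$. Then there exist constants $M,c\in(0,\infty)$ such that for all $(x,w)$ with $w\,\pi(\mathrm dx)/q(\mathrm dx)\ge M$ the following drift inequalities hold, in case (a) and case (b) respectively: $$\tilde PV_{(a)}(x,w)\le V_{(a)}(x,w)-c\,\kappa\bigl(V_{(a)}(x,w)\bigr),$$ $$\tilde PV_{(b)}(x,w)\le V_{(b)}(x,w)-c\,V_{(b)}^{1-1/\beta}(x,w),$$ where $V_{(a)}(x,w)=\exp\bigl((w\,\pi(\mathrm dx)/q(\mathrm dx))^\gamma\bigr)$, $\kappa(t)=t(\log t)^{-1/\gamma}$ and $V_{(b)}(x,w)=(w\,\pi(\mathrm dx)/q(\mathrm dx))^\beta+1$.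
   Context: Let $(\mathsf X,\mathcal B(\mathsf X))$ be a measurable space, $\pi$ and $q$ probability measures on it with $\pi\ll q$; the proposal kernel is $q(x,\mathrm dy)=q(\mathrm dy)$ for all $x$. With $\mu$ a fixed version of the density $\mathrm d\pi/\mathrm dq$ (written $\pi(\mathrm dx)/q(\mathrm dx)$), the acceptance ratio is $r(x,y)=\frac{\pi(\mathrm dy)q(\mathrm dx)}{\pi(\mathrm dx)q(\mathrm dy)}=\mu(y)/\mu(x)$ (only points with $\mu(x)>0$ are relevant). Let $\mathsf W$ be a Borel subset of $\mathbb R_+=[0,\infty)$ and let $x\mapsto Q_x$ be a probability kernel from $\mathsf X$ to $\mathsf W$ with $\int w\,Q_x(\mathrm dw)=1$ for all $x$. Put $\tilde\pi(\mathrm dx,\mathrm dw)=\pi(\mathrm dx)\,w\,Q_x(\mathrm dw)$. The pseudo-marginal kernel is $\tilde P(x,w;\mathrm dy,\mathrm du)=\min\{1,r(x,y)\frac uw\}q(\mathrm dy)Q_y(\mathrm du)+\delta_{x,w}(\mathrm dy,\mathrm du)\tilde\rho(x,w)$ with $\tilde\rho(x,w)=1-\iint\min\{1,r(x,y)\frac uw\}q(\mathrm dy)Q_y(\mathrm du)$, and $\tilde PV(x,w)=\int\tilde P(x,w;\mathrm dy,\mathrm du)V(y,u)$. *)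

(* Defs.v *)
From HB Require Import structures.
From mathcomp Require Import all_boot all_order all_algebra.
From mathcomp Require Import all_classical all_reals all_analysis measurable_realfun.

Set Implicit Arguments.
Unset Strict Implicit.
Unset Printing Implicit Defensive.
Import Order.TTheory GRing.Theory Num.Theory.
Import numFieldNormedType.Exports.

Local Open Scope classical_set_scope.
Local Open Scope ring_scope.
Local Open Scope ereal_scope.

(* Every [measurableType] is pointed, hence the nonemptiness field; it costs no
   generality, since a nonempty space carries the kernel [Q] into [W]. *)
Record weightSpace (R : realType) := WeightSpace {
  weight_set : set R ;
  weight_set_borel : measurable weight_set ;
  weight_set_ge0 : forall w, weight_set w -> (0 <= w)%R ;
  weight_set_nonempty : weight_set !=set0 }.

Definition weight (R : realType) (W : weightSpace R) : Type :=
  set_type (weight_set W).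
Coercion weight : weightSpace >-> Sortclass.

Definition wval (R : realType) (W : weightSpace R) (w : W) : R := sval w.

Definition weight_display : measure_display. Proof. exact. Qed.

Section weight_measurable.
Context (R : realType) (W : weightSpace R).

Let point_weight : weight W.
Proof.
by have [w Ww] := cid (weight_set_nonempty W); exists w; exact: mem_set.
Qed.

HB.instance Definition _ := Choice.copy (weight W) (set_type (weight_set W)).
HB.instance Definition _ := isPointed.Build (weight W) point_weight.

Let trace : set (set (weight W)) :=
  preimage_set_system setT (@wval R W) measurable.

Let sigma_algebra_trace : sigma_algebra setT trace.
Proof. by apply: sigma_algebra_preimage; exact: sigma_algebra_measurable. Qed.

Let trace0 : trace set0. Proof. by case: sigma_algebra_trace. Qed.
Let traceC A : trace A -> trace (~` A).
Proof. by case: sigma_algebra_trace => _ + _ => /[apply]; rewrite setTD. Qed.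
Let traceU (F : (set (weight W))^nat) :
  (forall i, trace (F i)) -> trace (\bigcup_i F i).
Proof. by case: sigma_algebra_trace => _ _; exact. Qed.

HB.instance Definition _ := @isMeasurable.Build weight_display (weight W)
  trace trace0 traceC traceU.

Lemma measurable_wval : measurable_fun setT (@wval R W).
Proof. by move=> _ B mB; exists B. Qed.

Lemma wval_ge0 (w : W) : (0 <= wval w)%R.
Proof. exact/(@weight_set_ge0 _ W)/set_valP. Qed.

End weight_measurable.

Record density d (X : measurableType d) (R : realType)
    (pi q : probability X R) := Density {
  dens :> X -> R ;
  dens_ge0 : forall x, (0 <= dens x)%R ;
  measurable_dens : measurable_fun setT dens ;
  densE : forall A, measurable A -> pi A = \int[q]_(x in A) (dens x)%:E }.

(* The measure [m(dy) Q_y(du) f(y,u)] *)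
Section kweight.
Context d d' (X : measurableType d) (Y : measurableType d') (R : realType).
Variables (m : probability X R) (Q : R.-pker X ~> Y) (f : X * Y -> R).

Definition kweight (mf : measurable_fun setT f) (f0 : forall z, (0 <= f z)%R)
    (A : set (X * Y)) : \bar R :=
  \int[m]_y \int[Q y]_u (f (y, u) * \1_A (y, u))%:E.

Hypotheses (mf : measurable_fun setT f) (f0 : forall z, (0 <= f z)%R).

Let integrand_ge0 A z : 0 <= (f z * \1_A z)%:E.
Proof. by rewrite lee_fin mulr_ge0. Qed.

Let measurable_integrand A : measurable A ->
  measurable_fun setT (fun z => (f z * \1_A z)%:E).
Proof.
by move=> mA; apply/measurable_EFinP; apply: measurable_funM => //;
  exact: measurable_indic.
Qed.

Let inner A y := \int[Q y]_u (f (y, u) * \1_A (y, u))%:E.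

Let measurable_inner A : measurable A -> measurable_fun setT (inner A).
Proof.
move=> mA.
apply: (@measurable_kfcomp _ _ X Y R Q (fun z => (f z * \1_A z)%:E)) => //.
exact: measurable_integrand.
Qed.

Let inner_ge0 A y : 0 <= inner A y.
Proof. by apply: integral_ge0 => u _; exact: integrand_ge0. Qed.

Let kweight0 : kweight mf f0 set0 = 0.
Proof.
apply: integral0_eq => y _; apply: integral0_eq => u _.
by rewrite indic0 mulr0.
Qed.

Let kweight_ge0 A : 0 <= kweight mf f0 A.
Proof. by apply: integral_ge0 => y _; exact: inner_ge0. Qed.

Let kweight_additive : semi_sigma_additive (kweight mf f0).
Proof.
move=> F mF tF mUF.
have -> : kweight mf f0 (\bigcup_n F n) = \sum_(0 <= n <oo) kweight mf f0 (F n).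
  have E y : inner (\bigcup_n F n) y = \sum_(0 <= n <oo) inner (F n) y.
    have mg n : measurable_fun setT (fun u => (f (y, u) * \1_(F n) (y, u))%:E).
      exact: measurableT_comp (measurable_integrand (mF n)) _.
    have g0 n u : setT u -> 0 <= (f (y, u) * \1_(F n) (y, u))%:E.
      by move=> _; exact: integrand_ge0.
    rewrite -(integral_nneseries _ measurableT mg g0).
    apply: eq_integral => u _.
    rewrite EFinM indic_bigcup// -nneseriesZl//.
  have mi n := measurable_inner (mF n).
  have i0 n y : setT y -> 0 <= inner (F n) y by move=> _; exact: inner_ge0.
  rewrite /kweight -(integral_nneseries _ measurableT mi i0).
  by apply: eq_integral => y _; exact: E.
by apply: is_cvg_nneseries => n _ _; exact: kweight_ge0.
Qed.

HB.instance Definition _ := isMeasure.Build _ _ _ (kweight mf f0)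
  kweight0 kweight_ge0 kweight_additive.

End kweight.

Section pseudo_marginal.
Context d (X : measurableType d) (R : realType) (W : weightSpace R).
Variables (pi q : probability X R) (mu : density pi q) (Q : R.-pker X ~> W).

Let measurable_wval_snd : measurable_fun setT (fun z : X * W => wval z.2).
Proof. by apply: measurableT_comp => //; exact: measurable_wval. Qed.

Let wval_snd_ge0 (z : X * W) : (0 <= wval z.2)%R.
Proof. exact: wval_ge0. Qed.

Definition pi_tilde : {measure set (X * W) -> \bar R} :=
  kweight pi Q measurable_wval_snd wval_snd_ge0.

(* As division by zero returns zero, this is meaningful for [0 < mu x] only. *)
Definition acceptance_ratio (x y : X) : R := (mu y / mu x)%R.

Definition acceptance (z z' : X * W) : R :=
  Num.min 1%R (acceptance_ratio z.1 z'.1 * (wval z'.2 / wval z.2))%R.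

Let acceptance_ge0 z z' : (0 <= acceptance z z')%R.
Proof.
by rewrite /acceptance le_min ler01/= mulr_ge0// divr_ge0// ?dens_ge0 ?wval_ge0.
Qed.

Let acceptance_le1 z z' : (acceptance z z' <= 1)%R.
Proof. by rewrite /acceptance ge_min lexx. Qed.

Let measurable_acceptance z : measurable_fun setT (acceptance z).
Proof.
apply: measurable_minr => //; apply: measurable_funM.
  apply: measurable_funM => //.
  by apply: measurableT_comp => //; exact: measurable_dens.
by apply: measurable_funM.
Qed.

Definition accepted_move (z : X * W) : {measure set (X * W) -> \bar R} :=
  kweight q Q (measurable_acceptance z) (acceptance_ge0 z).

Definition rejection_prob (z : X * W) : \bar R :=
  1 - \int[q]_y \int[Q y]_u (acceptance z (y, u))%:E.

Definition pm_kernel (z : X * W) (A : set (X * W)) : \bar R :=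
  accepted_move z A + rejection_prob z * \d_z A.

Let accepted_moveT z :
  accepted_move z setT = \int[q]_y \int[Q y]_u (acceptance z (y, u))%:E.
Proof.
apply: eq_integral => y _; apply: eq_integral => u _.
by rewrite indicT mulr1.
Qed.

Let accepted_moveT_le1 z : accepted_move z setT <= 1.
Proof.
rewrite accepted_moveT.
have le1 y : \int[Q y]_u (acceptance z (y, u))%:E <= 1.
  rewrite -(@prob_kernel _ _ _ _ _ Q y) -[leRHS]mul1e -integral_cst//.
  apply: ge0_le_integral => //.
  - by move=> u _; rewrite lee_fin.
  - apply/measurable_EFinP.
    exact: measurableT_comp (measurable_acceptance z) _.
  - by move=> u _; rewrite lee_fin.
rewrite -(@probability_setT _ _ _ q) -[leRHS]mul1e -integral_cst//.
apply: ge0_le_integral => //.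
- by move=> y _; apply: integral_ge0 => u _; rewrite lee_fin.
- apply: (@measurable_kfcomp _ _ X W R Q (fun z' => (acceptance z z')%:E)).
    by apply/measurable_EFinP; exact: measurable_acceptance.
  by move=> z'; rewrite lee_fin.
Qed.

Let accepted_moveT_fin z : accepted_move z setT \is a fin_num.
Proof.
rewrite ge0_fin_numE; last exact: measure_ge0.
exact: le_lt_trans (accepted_moveT_le1 z) (ltry _).
Qed.

Let rejection_prob_ge0 z : 0 <= rejection_prob z.
Proof. by rewrite /rejection_prob -accepted_moveT sube_ge0//
  accepted_moveT_fin. Qed.

Let rejection_prob_fin z : rejection_prob z \is a fin_num.
Proof. by rewrite /rejection_prob -accepted_moveT fin_numB
  accepted_moveT_fin. Qed.

Let pm_kernel0 z : pm_kernel z set0 = 0.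
Proof. by rewrite /pm_kernel !measure0 mule0 adde0. Qed.

Let pm_kernel_ge0 z A : 0 <= pm_kernel z A.
Proof. by rewrite /pm_kernel adde_ge0// mule_ge0. Qed.

Let pm_kernel_additive z : semi_sigma_additive (pm_kernel z).
Proof.
have r0 : (0 <= fine (rejection_prob z))%R by exact: fine_ge0.
have -> : pm_kernel z = measure_add (accepted_move z)
    (mscale (NngNum r0) (\d_z : {measure set (X * W) -> \bar R})).
  apply/funext => A; rewrite measure_addE /pm_kernel; congr (_ + _).
  by rewrite /= /mscale -[in LHS](fineK (rejection_prob_fin z)).
exact: measure_semi_sigma_additive.
Qed.

HB.instance Definition _ z := isMeasure.Build _ _ _ (pm_kernel z)
  (pm_kernel0 z) (pm_kernel_ge0 z) (@pm_kernel_additive z).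

Let pm_kernelT z : pm_kernel z setT = 1.
Proof.
rewrite /pm_kernel diracT mule1 /rejection_prob -accepted_moveT.
by rewrite addeC subeK.
Qed.

HB.instance Definition _ z :=
  Measure_isProbability.Build _ _ _ (pm_kernel z) (pm_kernelT z).

Definition pm_apply (V : X * W -> R) (z : X * W) : \bar R :=
  \int[pm_kernel z]_z' (V z')%:E.

Definition scaled_weight (z : X * W) : R := (wval z.2 * mu z.1)%R.

Definition V_exp (gamma : R) (z : X * W) : R := expR (scaled_weight z `^ gamma).

Definition V_pow (beta : R) (z : X * W) : R := (scaled_weight z `^ beta + 1)%R.

End pseudo_marginal.

Definition kappa (R : realType) (gamma t : R) : R := (t * ln t `^ (- gamma^-1))%R.

(* Main.v *)
Require Import Defs.
From HB Require Import structures.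
From mathcomp Require Import all_boot all_order all_algebra.
From mathcomp Require Import all_classical all_reals all_analysis measurable_realfun.
From mathcomp Require Import ring lra.

Set Implicit Arguments.
Unset Strict Implicit.
Unset Printing Implicit Defensive.
Import Order.TTheory GRing.Theory Num.Theory.
Import numFieldNormedType.Exports.

Local Open Scope classical_set_scope.
Local Open Scope ring_scope.
Local Open Scope ereal_scope.

(** Everything happens through the scaled weight s(x, w) = w mu(x).  The proposal
ignores the current state and the acceptance probability of a move from z to z'
is min(1, s(z') / s(z)), so the chain only sees the law of s under the proposal
measure nu(dy, du) = q(dy) Q_y(du), a probability under which s has mean 1.
Moreover pi-tilde has density s with respect to nu, so a moment assumption on
phi(s) under pi-tilde says that C, the nu-integral of s phi(s), is finite.

Take V = phi(s) and a state with s = s(z) >= 1.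
- Accepted moves contribute at most C / s to the expectation of V, because
  min(1, s' / s) <= s' / s.
- A move is accepted with probability at least m / s, where m is the nu-integral
  of min(1, s), because min(1, s' / s) >= min(1, s') / s as soon as s >= 1.
Hence PV <= V + (C - m V) / s, and where V >= 2 C / m this is at most
V - (m / 2) V / s.  The constant m is positive since s has mean 1.  This is
[drift_of_moment].

Both drift inequalities are instances, as both functions phi tend to infinity.
For V = exp(s^gamma) the rate V / s is exactly kappa(V); for V = s^beta + 1 one
has s <= V^(1/beta), so V / s dominates V^(1 - 1/beta).

The measures in the statement are defined by their values on sets.  The passage
to integrals of functions is the uniqueness principle [ge0_integral_unique]. *)

(** * Integrals against measures defined by their values on sets *)

Section integral_unique.
Import HBNNSimple.

(** Linearity extends the agreement on indicators to simple functions, and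
monotone convergence extends it to their nondecreasing limits. *)
Lemma ge0_integral_unique d (T : measurableType d) (R : realType)
    (m : {measure set T -> \bar R}) (I : (T -> \bar R) -> \bar R) :
  (forall A, measurable A -> I (fun x => (\1_A x)%:E) = m A) ->
  (forall (c : R) f g, (0 <= c)%R ->
    measurable_fun setT f -> (forall x, 0 <= f x) ->
    measurable_fun setT g -> (forall x, 0 <= g x) ->
    I (fun x => c%:E * f x + g x) = c%:E * I f + I g) ->
  (forall u : (T -> \bar R)^nat,
    (forall n, measurable_fun setT (u n)) -> (forall n x, 0 <= u n x) ->
    (forall x, {homo u ^~ x : n k / (n <= k)%N >-> n <= k}) ->
    I (fun x => limn (u ^~ x)) = limn (fun n => I (u n))) ->
  forall g, measurable_fun setT g -> (forall x, 0 <= g x) ->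
  \int[m]_x g x = I g.
Proof.
move=> I1 Ilin Imon g mg g0.
have I0 : I (fun=> 0) = 0.
  transitivity (I (fun x => (\1_(set0 : set T) x)%:E)); last first.
    by rewrite I1// measure0.
  by congr I; apply/funext => x; rewrite indic0.
have Isum (h : {nnsfun T >-> R}) (s : seq R) : (forall r, r \in s -> 0 <= r)%R ->
    I (fun x => \sum_(r <- s) r%:E * (\1_(h @^-1` [set r]) x)%:E) =
    \sum_(r <- s) r%:E * m (h @^-1` [set r]).
  elim: s => [_|r s IHs s0].
    rewrite big_nil -[RHS]I0; congr I; apply/funext => x; rewrite big_nil//.
  have r0 : (0 <= r)%R by apply: s0; rewrite mem_head.
  have s0' t : t \in s -> (0 <= t)%R.
    by move=> ts; apply: s0; rewrite in_cons ts orbT.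
  rewrite big_cons -IHs// -(I1 (h @^-1` [set r]))//.
  under [in LHS]eq_fun do rewrite big_cons.
  apply: Ilin => //.
  - exact/measurable_EFinP/measurable_indic.
  - apply: emeasurable_sum => t.
    apply: emeasurable_funM => //; exact/measurable_EFinP/measurable_indic.
  - move=> x; rewrite big_seq; apply: sume_ge0 => t ts.
    by rewrite mule_ge0// lee_fin s0'.
have Isimple (h : {nnsfun T >-> R}) : I (fun x => (h x)%:E) = \int[m]_x (h x)%:E.
  rewrite integralT_nnsfun sintegralE fsbig_finite//= -Isum.
    congr I; apply/funext => x.
    by rewrite [in LHS]fimfunE fsbig_finite//= -sumEFin.
  by move=> r; rewrite in_fset_set// inE => -[x _ <-]; exact: fun_ge0.
pose g_ := nnsfun_approx measurableT mg.
have mg_ n : measurable_fun setT (EFin \o g_ n) by exact/measurable_EFinP.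
have g_0 n x : 0 <= (EFin \o g_ n) x by rewrite lee_fin.
have nd x : {homo (fun n => (EFin \o g_ n) x) : n k / (n <= k)%N >-> n <= k}.
  by move=> a b ab; rewrite lee_fin; exact/lefP/nd_nnsfun_approx.
have -> : g = (fun x => limn (fun n => (EFin \o g_ n) x)).
  by apply/funext => x; apply/esym/cvg_lim => //; exact: cvg_nnsfun_approx.
rewrite Imon// monotone_convergence//.
by congr (limn _); apply/funext => n; rewrite -Isimple.
Qed.

End integral_unique.

Lemma ge0_integral_density d (T : measurableType d) (R : realType)
    (nu m : {measure set T -> \bar R}) (f : T -> R) :
  measurable_fun setT f -> (forall x, 0 <= f x)%R ->
  (forall A, measurable A -> m A = \int[nu]_x ((f x)%:E * (\1_A x)%:E)) ->
  forall g, measurable_fun setT g -> (forall x, 0 <= g x) ->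
  \int[m]_x g x = \int[nu]_x ((f x)%:E * g x).
Proof.
move=> mf f0 mE.
have mfM (g : T -> \bar R) : measurable_fun setT g ->
    measurable_fun setT (fun x => (f x)%:E * g x).
  by move=> mg; apply: emeasurable_funM => //; exact/measurable_EFinP.
have fM0 (g : T -> \bar R) : (forall x, 0 <= g x) ->
    forall x, setT x -> 0 <= (f x)%:E * g x.
  by move=> g0 x _; rewrite mule_ge0// lee_fin.
apply: ge0_integral_unique => [A mA|c g h c0 mg g0 mh h0|u mu u0 nd].
- by rewrite mE.
- rewrite -ge0_integralZl//; [|exact: mfM|exact: fM0].
  rewrite -ge0_integralD//; [|..].
  + apply: eq_integral => x _; rewrite ge0_muleDr; [|exact: mule_ge0|exact: h0].
    by congr (_ + _); exact: muleCA.
  + by move=> x _; rewrite mule_ge0 ?fM0.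
  + by apply: emeasurable_funM => //; exact: mfM.
  + exact: fM0.
  + exact: mfM.
- rewrite -monotone_convergence//.
  + apply: eq_integral => x _; rewrite limeMl//.
    by apply: ereal_nondecreasing_is_cvgn => a b; exact: nd.
  + by move=> n; exact: mfM.
  + by move=> n; exact: fM0.
  + by move=> x _ a b ab; rewrite lee_wpmul2l ?lee_fin// nd.
Qed.

(** The iterated integral is linear and monotonically continuous in the
integrand, since each of its two layers is. *)
Lemma ge0_integral_kweight d d' (X : measurableType d) (Y : measurableType d')
    (R : realType) (m : probability X R) (Q : R.-pker X ~> Y) (f : X * Y -> R)
    (mf : measurable_fun setT f) (f0 : forall z, (0 <= f z)%R) g :
  measurable_fun setT g -> (forall z, 0 <= g z) ->
  \int[kweight m Q mf f0]_z g z =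
  \int[m]_y \int[Q y]_u ((f (y, u))%:E * g (y, u)).
Proof.
have mfM (g' : X * Y -> \bar R) : measurable_fun setT g' ->
    measurable_fun setT (fun z => (f z)%:E * g' z).
  by move=> mg; apply: emeasurable_funM => //; exact/measurable_EFinP.
have fM0 (g' : X * Y -> \bar R) : (forall z, 0 <= g' z) ->
    forall z, 0 <= (f z)%:E * g' z.
  by move=> g0 x; rewrite mule_ge0// lee_fin.
pose J (h : X * Y -> \bar R) y := \int[Q y]_u ((f (y, u))%:E * h (y, u)).
have mJ h : measurable_fun setT h -> (forall z, 0 <= h z) ->
    measurable_fun setT (J h).
  move=> mh h0.
  apply: (@measurable_kfcomp _ _ X Y R Q (fun z => (f z)%:E * h z)).
    exact: mfM.
  exact: fM0.
have J0 h : (forall z, 0 <= h z) -> forall y, setT y -> 0 <= J h y.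
  by move=> h0 y _; apply: integral_ge0 => u _; exact: fM0.
have mfMy h y : measurable_fun setT h ->
    measurable_fun setT (fun u => (f (y, u))%:E * h (y, u)).
  by move=> mh; exact: measurableT_comp (mfM h mh) _.
have fM0y h y : (forall z, 0 <= h z) ->
    forall u, setT u -> 0 <= (f (y, u))%:E * h (y, u).
  by move=> h0 u _; exact: fM0.
move: g; apply: ge0_integral_unique => [A mA|c h k c0 mh h0 mk k0|u mu u0 nd].
- by [].
- rewrite -/(J h) -/(J k) -ge0_integralZl//; [|exact: mJ|exact: J0].
  rewrite -ge0_integralD//; last 4 first.
  + by move=> y _; rewrite mule_ge0 ?J0.
  + by apply: emeasurable_funM => //; exact: mJ.
  + exact: J0.
  + exact: mJ.
  apply: eq_integral => y _.
  rewrite -ge0_integralZl//; [|exact: mfMy|exact: fM0y].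
  rewrite -ge0_integralD//; last 4 first.
  + by move=> t _; rewrite mule_ge0 ?fM0.
  + by apply: emeasurable_funM => //; exact: mfMy.
  + exact: fM0y.
  + exact: mfMy.
  apply: eq_integral => t _; rewrite ge0_muleDr; [|exact: mule_ge0|exact: k0].
  by congr (_ + _); exact: muleCA.
- have Jnd y a b : (a <= b)%N -> J (u a) y <= J (u b) y.
    move=> ab; apply: ge0_le_integral => //; [exact: fM0y|exact: mfMy..|].
    by move=> t _; rewrite lee_wpmul2l ?lee_fin// nd.
  rewrite -(@monotone_convergence _ _ _ m setT measurableT (fun n => J (u n))).
  + apply: eq_integral => y _.
    rewrite -monotone_convergence//.
    * apply: eq_integral => t _; rewrite limeMl//.
      by apply: ereal_nondecreasing_is_cvgn => a b; exact: nd.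
    * by move=> n; exact: mfMy.
    * by move=> n; exact: fM0y.
    * by move=> t _ a b ab; rewrite lee_wpmul2l ?lee_fin// nd.
  + by move=> n; exact: mJ.
  + by move=> n; exact: J0.
  + by move=> y _ a b; exact: Jnd.
Qed.

(** * The proposal measure and the densities with respect to it *)

Section independent_pseudo_marginal.
Context d (X : measurableType d) (R : realType) (W : weightSpace R).
Context (pi q : probability X R) (mu : density pi q) (Q : R.-pker X ~> W).

Lemma measurable_scaled_weight : measurable_fun setT (scaled_weight mu : X * W -> R).
Proof.
apply: measurable_funM.
  by apply: measurableT_comp => //; exact: measurable_wval.
by apply: measurableT_comp => //; exact: measurable_dens.
Qed.

Lemma scaled_weight_ge0 (z : X * W) : (0 <= scaled_weight mu z)%R.
Proof. by rewrite mulr_ge0// ?wval_ge0// dens_ge0. Qed.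

(** The two ratios, of densities and of weights, only enter through the ratio of
scaled weights. *)
Lemma acceptanceE (z z' : X * W) :
  acceptance mu z z' = Num.min 1%R (scaled_weight mu z' / scaled_weight mu z)%R.
Proof.
rewrite /acceptance /acceptance_ratio /scaled_weight invfM; congr Num.min; ring.
Qed.

Lemma acceptance_ge0 (z z' : X * W) : (0 <= acceptance mu z z')%R.
Proof. by rewrite acceptanceE le_min ler01/= divr_ge0 ?scaled_weight_ge0. Qed.

Lemma acceptance_le1 (z z' : X * W) : (acceptance mu z z' <= 1)%R.
Proof. by rewrite acceptanceE ge_min lexx. Qed.

Lemma measurable_acceptance (z : X * W) : measurable_fun setT (acceptance mu z).
Proof.
rewrite (funext (acceptanceE z)); apply: measurable_minr => //.
by apply: measurable_funM => //; exact: measurable_scaled_weight.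
Qed.

Let measurable_one : measurable_fun setT (cst 1 : X * W -> R)%R.
Proof. exact: measurable_cst. Qed.

Definition proposal_law : {measure set (X * W) -> \bar R} :=
  kweight q Q measurable_one (fun=> ler01).

Local Notation nu := proposal_law.
Local Notation S := (scaled_weight mu).

Lemma ge0_integral_proposal_law (g : X * W -> \bar R) :
  measurable_fun setT g -> (forall z, 0 <= g z) ->
  \int[nu]_z g z = \int[q]_y \int[Q y]_u g (y, u).
Proof.
move=> mg g0; rewrite [LHS](ge0_integral_kweight _ _ _ _ mg g0).
by apply: eq_integral => y _; apply: eq_integral => u _; rewrite mul1e.
Qed.

Lemma proposal_lawT : nu setT = 1.
Proof.
rewrite -[LHS]mul1e -integral_cst// ge0_integral_proposal_law//.
under eq_integral do rewrite integral_cst// mul1e prob_kernel.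
by rewrite integral_cst// mul1e; exact: probability_setT.
Qed.

Lemma ge0_integral_accepted_move z (g : X * W -> \bar R) :
  measurable_fun setT g -> (forall z', 0 <= g z') ->
  \int[accepted_move mu Q z]_z' g z' =
  \int[nu]_z' ((acceptance mu z z')%:E * g z').
Proof.
move=> mg g0; rewrite [LHS](ge0_integral_kweight _ _ _ _ mg g0).
rewrite ge0_integral_proposal_law//.
- apply: emeasurable_funM => //.
  by apply/measurable_EFinP; exact: measurable_acceptance.
- by move=> z'; apply: mule_ge0 => //; rewrite lee_fin acceptance_ge0.
Qed.

(** One factor of the density, the weight, comes from the definition of
[pi_tilde]; the other, [mu], from rewriting the outer integral against [pi] as
an integral against [q]. *)
Lemma ge0_integral_pi_tilde (g : X * W -> \bar R) :
  measurable_fun setT g -> (forall z, 0 <= g z) ->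
  \int[pi_tilde pi Q]_z g z = \int[nu]_z ((S z)%:E * g z).
Proof.
move=> mg g0; rewrite [LHS](ge0_integral_kweight _ _ _ _ mg g0).
rewrite ge0_integral_proposal_law; last 2 first.
- apply: emeasurable_funM => //.
  by apply/measurable_EFinP; exact: measurable_scaled_weight.
- by move=> z'; apply: mule_ge0 => //; rewrite lee_fin scaled_weight_ge0.
have mwg : measurable_fun setT (fun z : X * W => (wval z.2)%:E * g z).
  apply: emeasurable_funM => //; apply/measurable_EFinP.
  by apply: measurableT_comp => //; exact: measurable_wval.
have wg0 (z : X * W) : 0 <= (wval z.2)%:E * g z.
  by apply: mule_ge0 => //; rewrite lee_fin wval_ge0.
rewrite (@ge0_integral_density _ _ _ q pi mu).
- apply: eq_integral => y _; rewrite -ge0_integralZl//.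
  + by apply: eq_integral => u _; rewrite /scaled_weight/= EFinM muleCA muleA.
  + exact: measurableT_comp mwg _.
  + by rewrite lee_fin dens_ge0.
- exact: measurable_dens.
- exact: dens_ge0.
- move=> A mA; rewrite [LHS](densE mu)// [LHS]integral_mkcond.
  apply: eq_integral => x _; rewrite patchE indicE.
  by case: ifPn; rewrite ?mule1 ?mule0.
- exact: (@measurable_kfcomp _ _ X W R Q (fun z => (wval z.2)%:E * g z)).
- by move=> y; apply: integral_ge0 => u _; exact: (wg0 (y, u)).
Qed.


(** * Action of the kernel on a function *)

Lemma integral_acceptance_le1 z : \int[nu]_z' (acceptance mu z z')%:E <= 1.
Proof.
rewrite -proposal_lawT -[leRHS]mul1e -integral_cst//.
apply: ge0_le_integral => //.
- by move=> z' _; rewrite lee_fin acceptance_ge0.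
- by apply/measurable_EFinP; exact: measurable_acceptance.
- by move=> z' _; rewrite lee_fin acceptance_le1.
Qed.

Lemma rejection_probE z :
  rejection_prob mu Q z = 1 - \int[nu]_z' (acceptance mu z z')%:E.
Proof.
rewrite /rejection_prob ge0_integral_proposal_law//.
- by apply/measurable_EFinP; exact: measurable_acceptance.
- by move=> z'; rewrite lee_fin acceptance_ge0.
Qed.

Lemma rejection_prob_ge0 z : 0 <= rejection_prob mu Q z.
Proof. by rewrite rejection_probE sube_ge0 ?orbT// integral_acceptance_le1. Qed.

Lemma rejection_prob_le1 z : rejection_prob mu Q z <= 1.
Proof.
rewrite rejection_probE geeDl// oppe_le0.
by apply: integral_ge0 => z' _; rewrite lee_fin acceptance_ge0.
Qed.

Lemma ge0_pm_apply (V : X * W -> R) z :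
  measurable_fun setT V -> (forall z', 0 <= V z')%R ->
  pm_apply mu Q V z =
  \int[nu]_z' ((acceptance mu z z')%:E * (V z')%:E)
  + rejection_prob mu Q z * (V z)%:E.
Proof.
move=> mV V0.
have mEV : measurable_fun setT (EFin \o V) by exact/measurable_EFinP.
have EV0 z' : 0 <= (EFin \o V) z' by rewrite lee_fin.
have r0 : (0 <= fine (rejection_prob mu Q z))%R by rewrite fine_ge0 ?rejection_prob_ge0.
have rfin : rejection_prob mu Q z \is a fin_num.
  rewrite ge0_fin_numE ?rejection_prob_ge0//.
  exact: le_lt_trans (rejection_prob_le1 z) (ltry _).
have E : \int[pm_kernel mu Q z]_z' (V z')%:E =
    \int[measure_add (accepted_move mu Q z) (mscale (NngNum r0) (\d_z))]_z' (V z')%:E.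
  apply: eq_measure_integral => A mA _.
  by rewrite [RHS]measure_addE /= /pm_kernel /mscale/= fineK.
rewrite /pm_apply E.
rewrite [LHS](ge0_integral_measure_add _ _ measurableT (fun z' _ => EV0 z') mEV).
apply: congr2; first exact: (ge0_integral_accepted_move z mEV EV0).
rewrite [LHS](ge0_integral_mscale _ measurableT _ mEV (fun z' _ => EV0 z'))/=.
rewrite fineK// integral_dirac//.
by rewrite diracT mul1e.
Qed.

(** * The drift inequality *)

Context (Q_mean1 : forall x, \int[Q x]_w (wval w)%:E = 1).

(** This is the total mass of [pi_tilde], which is 1 because every [Q x] has
mean 1. *)
Lemma integral_scaled_weight : \int[nu]_z (S z)%:E = 1.
Proof.
transitivity (\int[pi_tilde pi Q]_z (cst 1 z)).
  rewrite ge0_integral_pi_tilde//.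
  by apply: eq_integral => z _; rewrite mule1.
rewrite [LHS](ge0_integral_kweight _ _ _ _ (measurable_cst _) (fun=> lee01)).
transitivity (\int[pi]_y cst 1 y).
  apply: eq_integral => y _; rewrite -[RHS](Q_mean1 y).
  by apply: eq_integral => u _; rewrite mule1.
by rewrite integral_cst// mul1e; exact: probability_setT.
Qed.

(** Otherwise the scaled weight would vanish almost everywhere and could not have
mean 1. *)
Lemma integral_min1_scaled_weight_gt0 : 0 < \int[nu]_z (Num.min 1 (S z))%:E.
Proof.
have m0 (z : X * W) : (0 <= Num.min 1 (S z))%R.
  by rewrite le_min ler01/=; exact: scaled_weight_ge0.
have mm : measurable_fun setT (fun z : X * W => (Num.min 1 (S z))%:E).
  apply/measurable_EFinP; apply: measurable_minr => //.
  exact: measurable_scaled_weight.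
rewrite lt_def integral_ge0 ?andbT; last by move=> z _; rewrite lee_fin.
apply/eqP => E0.
have /ae_eq_integral_abs : \int[nu]_z `|(Num.min 1 (S z))%:E| = 0.
  by rewrite -[RHS]E0; apply: eq_integral => z _; rewrite gee0_abs// lee_fin.
move=> /(_ measurableT mm) ae0.
have := integral_scaled_weight.
rewrite (@ge0_ae_eq_integral _ _ _ _ _ _ (cst 0))//.
- by rewrite integral0 => /esym/eqP; rewrite onee_eq0.
- by apply/measurable_EFinP; exact: measurable_scaled_weight.
- by move=> z _; rewrite lee_fin scaled_weight_ge0.
- apply: filterS ae0 => z /(_ I) /= [] h _; congr EFin.
  by move: h; rewrite minEle; case: ifPn => // _ /eqP; rewrite oner_eq0.
Qed.

(** The threshold [K = 2 C / m] absorbs the constant [C] of the accepted moves into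
half of the loss [m * phi s]. *)
Lemma drift_of_moment (phi : R -> R) :
  measurable_fun setT phi -> (forall s, 0 <= phi s)%R ->
  \int[pi_tilde pi Q]_z (phi (S z))%:E < +oo ->
  exists K c : R, (0 < c)%R /\ forall z : X * W,
    (1 <= S z)%R -> (K <= phi (S z))%R ->
    pm_apply mu Q (phi \o S) z <= (phi (S z) - c * (phi (S z) / S z))%:E.
Proof.
move=> mphi phi0.
have mS : measurable_fun setT (S : X * W -> R) := measurable_scaled_weight.
have mV : measurable_fun setT (phi \o S : X * W -> R) by exact: measurableT_comp.
rewrite ge0_integral_pi_tilde; last 2 first.
- exact/measurable_EFinP.
- by move=> z; rewrite lee_fin.
set C := \int[nu]_z _ => Coo.
set m := \int[nu]_z (Num.min 1 (S z))%:E.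
have m0 : 0 < m := integral_min1_scaled_weight_gt0.
have C0 : 0 <= C.
  apply: integral_ge0 => z _; apply: mule_ge0; rewrite lee_fin//.
  exact: scaled_weight_ge0.
have CE : C = (fine C)%:E by rewrite fineK// ge0_fin_numE.
have mmin : measurable_fun setT (fun z : X * W => Num.min 1 (S z))%R.
  exact: measurable_minr.
have min0 (z : X * W) : (0 <= Num.min 1 (S z))%R.
  by rewrite le_min ler01/=; exact: scaled_weight_ge0.
have moo : m < +oo.
  apply: (@le_lt_trans _ _ 1); last exact: ltry.
  rewrite -integral_scaled_weight; apply: ge0_le_integral => //.
  - by move=> z _; rewrite lee_fin.
  - exact/measurable_EFinP.
  - exact/measurable_EFinP.
  - by move=> z _; rewrite lee_fin ge_min lexx orbT.
have mE : m = (fine m)%:E by rewrite fineK// ge0_fin_numE// ltW.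
have fm0 : (0 < fine m)%R by rewrite fine_gt0// m0.
exists (2 * fine C / fine m)%R, (fine m / 2)%R; split; first by rewrite divr_gt0.
move=> z S1 KV.
have s0 : (0 < S z)%R by exact: lt_le_trans S1.
have ma : measurable_fun setT (fun z' => (acceptance mu z z')%:E).
  by apply/measurable_EFinP; exact: measurable_acceptance.
(* Accepted moves: min(1, s' / s) <= s' / s. *)
have accC : \int[nu]_z' ((acceptance mu z z')%:E * ((phi \o S) z')%:E) <=
    (fine C / S z)%:E.
  rewrite mulrC EFinM -CE -ge0_integralZl//; last 3 first.
  - by apply: emeasurable_funM; exact/measurable_EFinP.
  - by move=> z' _; apply: mule_ge0; rewrite lee_fin// scaled_weight_ge0.
  - by rewrite lee_fin invr_ge0 ltW.
  apply: ge0_le_integral => //.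
  - by move=> z' _; apply: mule_ge0; rewrite lee_fin ?acceptance_ge0/=.
  - by apply: emeasurable_funM => //; exact/measurable_EFinP.
  - by apply: emeasurable_funM => //; apply: emeasurable_funM; exact/measurable_EFinP.
  - move=> z' _; rewrite -!EFinM lee_fin mulrA ler_wpM2r//=.
    by rewrite acceptanceE ge_min mulrC lexx orbT.
(* Acceptance probability: min(1, s' / s) >= min(1, s') / s, as 1 <= s. *)
have accm : (fine m / S z)%:E <= \int[nu]_z' (acceptance mu z z')%:E.
  rewrite mulrC EFinM -mE -ge0_integralZl//; last 3 first.
  - exact/measurable_EFinP.
  - by move=> z' _; rewrite lee_fin.
  - by rewrite lee_fin invr_ge0 ltW.
  apply: ge0_le_integral => //.
  - by move=> z' _; rewrite -EFinM lee_fin mulr_ge0// invr_ge0 ltW.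
  - by apply: emeasurable_funM => //; exact/measurable_EFinP.
  - move=> z' _; rewrite -EFinM lee_fin acceptanceE mulrC le_min.
    rewrite ler_pdivrMr// mul1r (le_trans _ S1) ?ge_min ?lexx//=.
    by rewrite ler_pM2r ?invr_gt0// ge_min lexx orbT.
have rejm : rejection_prob mu Q z <= (1 - fine m / S z)%:E.
  by rewrite rejection_probE EFinB leeB.
rewrite ge0_pm_apply//; last by move=> z'; exact: phi0.
apply: (@le_trans _ _ ((fine C / S z)%:E + (1 - fine m / S z)%:E * (phi (S z))%:E)).
  by apply: leeD => //; apply: lee_wpmul2r => //; exact: phi0.
rewrite -EFinM -EFinD lee_fin.
have -> : (fine C / S z + (1 - fine m / S z) * phi (S z) =
    phi (S z) - fine m / 2 * (phi (S z) / S z)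
    - (fine m * phi (S z) / 2 - fine C) / S z)%R by field; rewrite gt_eqF.
rewrite gerBl divr_ge0// ?(ltW s0)// subr_ge0.
by move: KV; rewrite ler_pdivrMr//; lra.
Qed.

End independent_pseudo_marginal.

(** * The exponential and polynomial drift functions *)

(** With [v] a value of the polynomial drift function, this bounds its rate by the
rate [v / s] of [drift_of_moment]: the hypothesis gives [s <= v `^ beta^-1]. *)
Lemma powR_1BV_le_div (R : realType) (beta s v : R) : (0 < beta)%R ->
  (0 < s)%R -> (s `^ beta <= v)%R -> (v `^ (1 - beta^-1) <= v / s)%R.
Proof.
move=> beta0 s0 sv.
have v0 : (0 < v)%R by apply: lt_le_trans sv; exact: powR_gt0.
rewrite powRD; last by apply/implyP => _; rewrite gt_eqF.
rewrite powRr1 ?(ltW v0)// ler_pM2l// powRN lef_pV2 ?posrE ?powR_gt0//.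
have -> : s = ((s `^ beta) `^ beta^-1)%R.
  by rewrite -powRrM divff ?gt_eqF// powRr1 ?ltW.
by apply: ge0_ler_powR => //;
  rewrite ?invr_ge0 ?nnegrE ?powR_ge0 ?(ltW beta0) ?(ltW v0).
Qed.

Theorem corollary27 (R : realType) (d : measure_display) (X : measurableType d)
    (pi q : probability X R) (pi_ac : pi `<< q) (mu : density pi q)
    (W : weightSpace R) (Q : R.-pker X ~> W)
    (Q_mean1 : forall x : X, \int[Q x]_w (wval w)%:E = 1) :
  (forall gamma : R, (0 < gamma)%R ->
    \int[pi_tilde pi Q]_z (expR (scaled_weight mu z `^ gamma))%:E < +oo ->
    exists M c : R, [/\ (0 < M)%R, (0 < c)%R &
      forall (x : X) (w : W), (M <= wval w * mu x)%R ->
        pm_apply mu Q (V_exp mu gamma) (x, w) <=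
          (V_exp mu gamma (x, w) - c * kappa gamma (V_exp mu gamma (x, w)))%:E])
  /\
  (forall beta : R, (1 <= beta)%R ->
    \int[pi_tilde pi Q]_z (scaled_weight mu z `^ beta)%:E < +oo ->
    exists M c : R, [/\ (0 < M)%R, (0 < c)%R &
      forall (x : X) (w : W), (M <= wval w * mu x)%R ->
        pm_apply mu Q (V_pow mu beta) (x, w) <=
          (V_pow mu beta (x, w)
            - c * V_pow mu beta (x, w) `^ (1 - beta^-1))%:E]).
Proof.
split=> [gamma gamma0 moment|beta beta1 moment].
- have mV : measurable_fun setT (fun s : R => expR (s `^ gamma)).
    by apply: measurableT_comp => //; exact: measurable_powR.
  have [K [c [c0 drift]]] := drift_of_moment Q_mean1 mV (fun=> expR_ge0 _) moment.
  (* [s >= M] gives [exp (s^gamma) >= 1 + s^gamma >= K]; the inner maximum makes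
     the root of [K] meaningful when [K] is negative. *)
  pose M := Num.max 1%R (Num.max 0 K `^ gamma^-1)%R.
  exists M, c; split => //; first by rewrite lt_max ltr01.
  move=> x w; rewrite ge_max => /andP[s1 sK].
  have s0 : (0 < scaled_weight mu (x, w))%R by exact: lt_le_trans s1.
  have -> : kappa gamma (V_exp mu gamma (x, w)) =
      (V_exp mu gamma (x, w) / scaled_weight mu (x, w))%R.
    by rewrite /kappa /V_exp expRK -powRrM mulrN divff ?gt_eqF// powR_inv1 ?ltW.
  apply: drift => //.
  apply: (@le_trans _ _ (1 + scaled_weight mu (x, w) `^ gamma)%R);
    last exact: expR_ge1Dx.
  apply: (@le_trans _ _ (Num.max 0 K)%R); first by rewrite le_max lexx orbT.
  have -> : (Num.max 0 K = (Num.max 0 K `^ gamma^-1) `^ gamma)%R.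
    by rewrite -powRrM mulVf ?gt_eqF// powRr1// le_max lexx.
  apply: (@le_trans _ _ (scaled_weight mu (x, w) `^ gamma)%R); last by rewrite lerDr.
  by apply: ge0_ler_powR; rewrite ?nnegrE ?powR_ge0// ltW.
- have beta0 : (0 < beta)%R by exact: lt_le_trans beta1.
  have mP : measurable_fun setT (fun s : R => s `^ beta)%R by exact: measurable_powR.
  have mV : measurable_fun setT (fun s : R => s `^ beta + 1)%R.
    exact: measurable_funD.
  have V0 (s : R) : (0 <= s `^ beta + 1)%R by rewrite addr_ge0 ?powR_ge0.
  have moment1 : \int[pi_tilde pi Q]_z (scaled_weight mu z `^ beta + 1)%:E < +oo.
    under eq_integral do rewrite EFinD.
    rewrite ge0_integralD//; last 2 first.
    + by move=> z _; rewrite lee_fin powR_ge0.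
    + apply/measurable_EFinP.
      exact: measurableT_comp mP (measurable_scaled_weight _).
    rewrite lte_add_pinfty//.
    rewrite [ltLHS](ge0_integral_pi_tilde mu)//.
    under eq_integral do rewrite mule1.
    by rewrite integral_scaled_weight// ltry.
  have [K [c [c0 drift]]] := drift_of_moment Q_mean1 mV V0 moment1.
  (* Since [1 <= beta], already [s >= max 1 K] gives [s^beta >= K]. *)
  exists (Num.max 1%R K), c; split => //; first by rewrite lt_max ltr01.
  move=> x w; rewrite ge_max => /andP[s1 sK].
  have s0 : (0 < scaled_weight mu (x, w))%R by exact: lt_le_trans s1.
  have sV : (scaled_weight mu (x, w) `^ beta <= V_pow mu beta (x, w))%R.
    by rewrite lerDl.
  have KV : (K <= scaled_weight mu (x, w) `^ beta + 1)%R.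
    apply: le_trans sV; apply: (le_trans sK).
    by rewrite -[leLHS]powRr1 ?(ltW s0)// ler_powR.
  apply: (le_trans (drift (x, w) s1 KV)).
  by rewrite lee_fin lerB// ler_pM2l//; exact: powR_1BV_le_div.
Qed.
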